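(* Let $\mathbb{F}\in\{\mathbb{R},\mathbb{C}\}$, let $\mathcal{X}=\mathrm{span}\{X_1,\dots,X_k\}\subset\mathbb{F}^{n\times n}$ be a $k$-dimensional subspace, and let $Y\in\mathbb{F}^{n\times n}\setminus\mathcal{X}$ and $X_*\in\mathcal{X}$ be given. Then $X_*$ satisfies $\|Y-X_*\|_2=\min_{X\in\mathcal{X}}\|Y-X\|_2$ if and only if $$0\in\mathrm{cvx}\left(\mathscr{F}(A_1,\dots,A_k;\Sigma_{Y-X_*})\right),$$ where $A_i=(Y-X_* )^HX_i$ for $i=1,\dots,k$, and $\mathrm{cvx}$ denotes the convex hull.
   Context: $\|v\|_2=(v^Hv)^{1/2}$ is the Euclidean norm on $\mathbb{F}^n$ and $\|A\|_2=\max_{v\in\mathbb{F}^n,\,\|v\|_2=1}\|Av\|_2$ is the spectral norm on $\mathbb{F}^{n\times n}$; $^H$ denotes the conjugate transpose. For an integer $k\ge 1$, matrices $A_1,\dots,A_k\in\mathbb{F}^{n\times n}$ and a subspace $\mathcal{S}\subseteq\mathbb{F}^n$ (over the same field $\mathbb{F}$), the $k$-dimensional field of the $k$ matrices $A_1,\dots,A_k$ restricted to $\mathcal{S}$ is $$\mathscr{F}(A_1,\dots,A_k;\mathcal{S})=\left\{[v^HA_1v,\dots,v^HA_kv]^T:\ v\in\mathcal{S},\ \|v\|_2=1\right\}\subset\mathbb{F}^k.$$ $\Sigma_{Y-X_*}\subseteq\mathbb{F}^n$ denotes the span of the maximal right singular vectors of $Y-X_*$, i.e., of the right singular vectors corresponding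 to the maximal singular value $\|Y-X_*\|_2$ of $Y-X_*$. *)

(* Defs.v *)
From HB Require Import structures.
From mathcomp Require Import all_boot all_order all_algebra.
From mathcomp Require Import classical_sets reals complex.

Set Implicit Arguments.
Unset Strict Implicit.
Unset Printing Implicit Defensive.

Import Order.TTheory GRing.Theory Num.Theory.
Local Open Scope classical_set_scope.
Local Open Scope ring_scope.

Inductive ground := Reals | Complexes.

Definition scalars (R : realType) (b : ground) : fieldType :=
  match b with Reals => R | Complexes => R[i] end.

Definition sconj (R : realType) (b : ground) : scalars R b -> scalars R b :=
  match b return scalars R b -> scalars R b
  with Reals => id | Complexes => @conjc R end.

Definition sre (R : realType) (b : ground) : scalars R b -> R :=
  match b return scalars R b -> R
  with Reals => id | Complexes => @complex.Re R end.

Definition of_real (R : realType) (b : ground) : R -> scalars R b :=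
  match b return R -> scalars R b
  with Reals => id | Complexes => real_complex R end.

Section Notions.
Variables (R : realType) (b : ground).
Local Notation F := (scalars R b).

Definition adjmx (m n : nat) (A : 'M[F]_(m, n)) : 'M[F]_(n, m) :=
  (map_mx (@sconj R b) A)^T.

(* [v^H v] is a nonnegative real; [sre] only moves it from [F] to [R]. *)
Definition norm2 (n : nat) (v : 'cV[F]_n) : R :=
  Num.sqrt (sre ((adjmx v *m v) 0 0)).

(* A maximum, by compactness of the unit sphere, as soon as [0 < n]. *)
Definition spectral_norm (n : nat) (A : 'M[F]_n) : R :=
  sup [set norm2 (A *m v) | v in [set v : 'cV[F]_n | norm2 v = 1]].

Definition right_singular_vector (n : nat) (A : 'M[F]_n) (s : R)
    (v : 'cV[F]_n) : Prop :=
  norm2 v = 1 /\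
  exists u : 'cV[F]_n,
    [/\ norm2 u = 1, A *m v = of_real b s *: u
      & adjmx A *m u = of_real b s *: v].

Definition lin_span (n : nat) (S : set 'cV[F]_n) : set 'cV[F]_n :=
  [set v | exists s : seq 'cV[F]_n,
    (forall w, w \in s -> S w) /\ v \in <<s>>%VS].

Definition max_right_singular_space (n : nat) (A : 'M[F]_n) : set 'cV[F]_n :=
  lin_span [set v | right_singular_vector A (spectral_norm A) v].

Definition restricted_field (n k : nat) (A : 'I_k -> 'M[F]_n)
    (S : set 'cV[F]_n) : set 'cV[F]_k :=
  [set \col_i (adjmx v *m A i *m v) 0 0 | v in [set v | S v /\ norm2 v = 1]].

(* The weights are real also when [F] is complex: [F^k] is regarded as a real
   vector space. *)
Definition convex_hull (k : nat) (S : set 'cV[F]_k) : set 'cV[F]_k :=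
  [set p | exists (m : nat) (t : 'I_m -> R) (q : 'I_m -> 'cV[F]_k),
    [/\ forall j, 0 <= t j, \sum_j t j = 1, forall j, S (q j)
      & p = \sum_j of_real b (t j) *: q j]].

End Notions.

(* Main.v *)
Require Import Defs.
From HB Require Import structures.
From mathcomp Require Import all_boot all_order all_algebra.
From mathcomp Require Import classical_sets reals complex.
From mathcomp Require Import topology normedtype derive.
From mathcomp Require Import ring lra.

(** Put D = Y - X_* and s = ||D||, which is positive since Y is not in the
    span.  The defect s^2 |v|^2 - |D v|^2 is a nonnegative quadratic form in v,
    so it vanishes exactly where its gradient does, i.e. where
    D^H D v = s^2 v; on unit vectors this describes the span of the maximal
    right singular vectors ([norm_defect_eq0],
    [max_right_singular_space_norm_defect],
    [norm_defect_max_right_singular_space]).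

    If 0 lies in the hull, with weights t_j and unit singular vectors v_j,
    then for every W in the span the average with weights t_j of
    Re <D v_j, W v_j> is 0.  As
    |(D - W) v_j|^2 >= s^2 - 2 Re <D v_j, W v_j>, averaging gives
    ||D - W||^2 >= s^2 ([best_approximation_of_hull]).

    For the converse, look at the joint range, over the whole unit sphere, of
    the defect and of the real and imaginary parts of v^H D^H X_i v.  A strict
    theorem of the alternative ([qforms_gordan], [rip_forms_gordan]) leaves
    two cases.

    Either 0 lies in the convex hull of this range.  The defect is
    nonnegative, so it must vanish at every point that carries weight: these
    points are maximal right singular vectors, and 0 lies in the hull of the
    restricted field ([convex_hull_restricted_field0]).

    Or a linear functional is at least mu > 0 on the range: for some W in the
    span and some real lam, Re <D v, W v> + lam * defect(v) >= mu on the
    sphere.  Then |(D - e W) v|^2 <= s^2 - e mu for small e > 0, uniformly in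
    v, so D - e W has a smaller norm than D ([spectral_norm_decrease]).

    Working on the whole sphere, with the defect as one more coordinate,
    makes the functional control vectors that are close to singular without
    being singular.  It also leaves a single compactness argument, namely the
    existence of a point of least norm in the hull of the joint range of
    finitely many real quadratic forms.  Complex vectors enter this argument
    through their coordinates in an orthonormal basis over the reals
    ([real_orthonormal_basis]). *)

Set Implicit Arguments.
Unset Strict Implicit.
Unset Printing Implicit Defensive.

Import Order.TTheory GRing.Theory Num.Theory.
Import numFieldNormedType.Exports.
Local Open Scope classical_set_scope.
Local Open Scope ring_scope.

(** * Joint ranges of real quadratic forms *)

Section QuadraticForms.
Variable R : realType.

Definition qform (N : nat) (M : 'M[R]_N) (x : 'rV[R]_N) : R :=
  (x *m M *m x^T) 0 0.

Lemma qformE N (M : 'M[R]_N) x :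
  qform M x = \sum_k (\sum_l x 0 l * M l k) * x 0 k.
Proof.
by rewrite /qform !mxE; apply: eq_bigr => k _; rewrite !mxE.
Qed.

Lemma qform1E N (x : 'rV[R]_N) : qform 1%:M x = \sum_k x 0 k ^+ 2.
Proof.
by rewrite /qform mulmx1 !mxE; apply: eq_bigr => k _; rewrite !mxE expr2.
Qed.

Lemma qform1_ge0 N (x : 'rV[R]_N) : 0 <= qform 1%:M x.
Proof. by rewrite qform1E sumr_ge0 // => k _; exact: sqr_ge0. Qed.

Lemma sqr_coord_le_qform1 N (x : 'rV[R]_N) k : x 0 k ^+ 2 <= qform 1%:M x.
Proof.
rewrite qform1E (bigD1 k) //= lerDl sumr_ge0 // => i _; exact: sqr_ge0.
Qed.

Lemma qformZ N (M : 'M[R]_N) a x : qform M (a *: x) = a ^+ 2 * qform M x.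
Proof.
by rewrite /qform linearZ /= -!(scalemxAl, scalemxAr) !mxE mulrA expr2.
Qed.

Lemma qform0 N (M : 'M[R]_N) : qform M 0 = 0.
Proof. by rewrite /qform !mul0mx mxE. Qed.

Lemma qform_le N (M : 'M[R]_N) x :
  qform M x <= (\sum_k \sum_l `|M l k|) * qform 1%:M x.
Proof.
rewrite qformE mulr_suml; apply: ler_sum => k _.
rewrite !mulr_suml; apply: ler_sum => l _.
rewrite mulrAC mulrC; apply: le_trans (ler_norm _) _.
rewrite normrM ler_wpM2l // normrM.
have := sqr_coord_le_qform1 x k; have := sqr_coord_le_qform1 x l.
have := sqr_ge0 (`|x 0 l| - `|x 0 k|).
rewrite -(real_normK (num_real (x 0 l))) -(real_normK (num_real (x 0 k))).
lra.
Qed.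

(** A name that unification matches syntactically, so that the closure lemmas
    below apply whichever topological structure elaboration infers. *)
Definition continuous_rV p (f : 'rV[R]_p -> R) : Prop := continuous f.

Lemma continuous_rV_sum p (J : Type) (r : seq J) (P : pred J)
    (F : J -> 'rV[R]_p -> R) :
  (forall j, P j -> continuous_rV (F j)) ->
  continuous_rV (fun x => \sum_(j <- r | P j) F j x).
Proof. by apply: (@continuous_big R); exact: add_continuous. Qed.

Lemma continuous_rVM p (f g : 'rV[R]_p -> R) :
  continuous_rV f -> continuous_rV g -> continuous_rV (fun x => f x * g x).
Proof. by move=> cf cg x; exact: cvgM (cf x) (cg x). Qed.

Lemma continuous_qform_row m N (M : 'M[R]_N) (j : 'I_m) :
  continuous_rV (fun x : 'rV[R]_(m * N) => qform M (row j (vec_mx x))).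
Proof.
rewrite (_ : (fun _ => _) = fun x : 'rV[R]_(m * N) => \sum_k
   (\sum_l x 0 (mxvec_index j l) * M l k) * x 0 (mxvec_index j k)); last first.
  apply: boolp.funext => x; rewrite qformE; apply: eq_bigr => k _.
  by rewrite !mxE; congr (_ * _); apply: eq_bigr => l _; rewrite !mxE.
apply: continuous_rV_sum => k _; apply: continuous_rVM.
  apply: continuous_rV_sum => l _; apply: continuous_rVM.
    by move=> x; exact: (@coord_continuous R 1 (m * N) 0 _ x).
  by move=> x; exact: (@cst_continuous _ _ (M l k)).
by move=> x; exact: (@coord_continuous R 1 (m * N) 0 _ x).
Qed.

(** A family of m vectors of total square norm 1 represents a convex combination
    of m points of the joint range of the forms on the sphere: the weights are
    the squared norms.  So this is a point of least Euclidean norm in that part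
    of the convex hull, and it exists because the families form a sphere. *)
Lemma qform_family_minimizer (I : finType) N m (M : I -> 'M[R]_N) :
  (0 < N)%N -> (0 < m)%N ->
  exists2 w : 'I_m -> 'rV[R]_N, \sum_j qform 1%:M (w j) = 1 &
    forall w' : 'I_m -> 'rV[R]_N, \sum_j qform 1%:M (w' j) = 1 ->
      \sum_i (\sum_j qform (M i) (w j)) ^+ 2
        <= \sum_i (\sum_j qform (M i) (w' j)) ^+ 2.
Proof.
move=> N0 m0.
pose rw (x : 'rV[R]_(m * N)) j := row j (vec_mx x).
pose S := [set x | \sum_j qform 1%:M (rw x j) = 1].
pose G x := \sum_i (\sum_j qform (M i) (rw x j)) ^+ 2.
have rwK (w : 'I_m -> 'rV[R]_N) :
    rw (mxvec (\matrix_(j, k) w j 0 k)) =1 w.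
  by move=> j; apply/rowP => k; rewrite /rw mxvecK !mxE.
have eq_rw (Q : 'M[R]_N) (w : 'I_m -> 'rV[R]_N) :
    \sum_j qform Q (rw (mxvec (\matrix_(j, k) w j 0 k)) j) =
    \sum_j qform Q (w j).
  by apply: eq_bigr => j _; rewrite rwK.
have contS Q : continuous_rV (fun x => \sum_j qform Q (rw x j)).
  by apply: continuous_rV_sum => j _; exact: continuous_qform_row.
have Sclosed : closed S.
  apply: (@preimage_closed _ _ (fun x => \sum_j qform 1%:M (rw x j))
    [set x | x = 1]); last exact: closed_eq.
  by move=> x _; exact: contS.
have Sbounded : bounded_set S.
  exists 1; split; first exact: num_real.
  move=> B B1 x Sx; apply: le_trans (ltW B1).
  rewrite [leLHS]mx_normrE; apply/bigmax_leP; split => // -[i q] _ /=.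
  rewrite (ord1 i) -(@expr_le1 _ 2) // real_normK ?num_real //.
  case/mxvec_indexP: q => j k; rewrite -Sx.
  rewrite (bigD1 j) //=; apply: le_trans (_ : qform 1%:M (rw x j) <= _).
    by apply: le_trans (sqr_coord_le_qform1 _ k); rewrite !mxE.
  by rewrite lerDl sumr_ge0 // => l _; exact: qform1_ge0.
have S0 : S !=set0.
  pose e : 'rV[R]_N := delta_mx 0 (Ordinal N0).
  pose w (j : 'I_m) := if j == Ordinal m0 then e else 0.
  exists (mxvec (\matrix_(j, k) w j 0 k)).
  rewrite /S /= eq_rw (bigD1 (Ordinal m0)) //= big1 ?addr0.
    rewrite /w eqxx qform1E (bigD1 (Ordinal N0)) //= big1 => [|k /negPf kN].
      by rewrite mxE !eqxx expr1n addr0.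
    by rewrite mxE kN andbF expr0n.
  by move=> j /negPf jN; rewrite /w jN qform0.
have contG : {within S, continuous G}.
  apply: continuous_subspaceT; rewrite -/(continuous_rV G).
  by apply: continuous_rV_sum => i _; apply: continuous_rVM; exact: contS.
have [x Sx minx] :=
  EVT_min_rV S0 (bounded_closed_compact Sbounded Sclosed) contG.
rewrite inE in Sx; exists (rw x) => // w' w'1.
have <- : G (mxvec (\matrix_(j, k) w' j 0 k)) =
    \sum_i (\sum_j qform (M i) (w' j)) ^+ 2.
  by apply: eq_bigr => i _; rewrite eq_rw.
by apply: minx; rewrite inE /S /= eq_rw.
Qed.

(** Caratheodory's reduction: a linear dependence a among the more than #|I|
    value vectors, scaled to have maximal entry 1, allows the vector w_j to be
    multiplied by sqrt(1 - a_j), which kills one vector and no sum. *)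
Lemma qform_family_zero_row (I : finType) N m (M : I -> 'M[R]_N)
    (w : 'I_m -> 'rV[R]_N) :
  (#|I| < m)%N ->
  exists w' : 'I_m -> 'rV[R]_N, (exists j0, w' j0 = 0) /\
    forall i, \sum_j qform (M i) (w' j) = \sum_j qform (M i) (w j).
Proof.
move=> ltIm.
pose B := \matrix_(j < m, l < #|I|) qform (M (enum_val l)) (w j).
have kerB : kermx B != 0.
  rewrite -mxrank_eq0 mxrank_ker subn_eq0 -ltnNge.
  exact: leq_ltn_trans (rank_leq_col B) ltIm.
have [a [j0 a0] aB] : exists2 a : 'rV[R]_m, exists j0, 0 < a 0 j0 & a *m B = 0.
  have /rowV0Pn[a /sub_kermxP aB /rV0Pn[j0]] := kerB.
  rewrite real_neqr_lt ?num_real // => /orP[a_lt0|a_gt0]; last first.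
    by exists a => //; exists j0.
  exists (- a); last by rewrite mulNmx aB oppr0.
  by exists j0; rewrite mxE oppr_gt0.
have aM i : \sum_j a 0 j * qform (M i) (w j) = 0.
  transitivity ((a *m B) 0 (enum_rank i)); last by rewrite aB mxE.
  by rewrite mxE; apply: eq_bigr => j _; rewrite mxE enum_rankK.
pose j1 := [arg max_(j > j0) a 0 j]%O.
have a_max j : a 0 j <= a 0 j1.
  by rewrite /j1; case: arg_maxP => //= l _ /(_ j isT).
have a1_gt0 : 0 < a 0 j1 by exact: lt_le_trans a0 (a_max _).
pose t j := 1 - a 0 j / a 0 j1.
have t_ge0 j : 0 <= t j by rewrite subr_ge0 ler_pdivrMr // mul1r.
exists (fun j => Num.sqrt (t j) *: w j); split.
  by exists j1; rewrite /t divff ?subrr ?sqrtr0 ?scale0r // gt_eqF.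
move=> i; under eq_bigr do rewrite qformZ sqr_sqrtr // mulrBl mul1r mulrAC.
by rewrite sumrB -mulr_suml aM mul0r subr0.
Qed.

(** The derivative at the end p of the squared norm along the segment from p to
    f is nonnegative if p is the point of least norm: this is the variational
    inequality of the projection onto a convex set. *)
Lemma sum_sqr_segment_min (I : finType) (p f : I -> R) :
  (forall e, 0 <= e <= 1 ->
    \sum_i p i ^+ 2 <= \sum_i ((1 - e) * p i + e * f i) ^+ 2) ->
  \sum_i p i ^+ 2 <= \sum_i p i * f i.
Proof.
move=> minp.
set P := \sum_i p i ^+ 2 in minp *; set Q := \sum_i p i * f i.
pose T := \sum_i (p i - f i) ^+ 2.
have T_ge0 : 0 <= T by apply: sumr_ge0 => i _; exact: sqr_ge0.
have expand e : \sum_i ((1 - e) * p i + e * f i) ^+ 2 =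
    P - 2 * e * (P - Q) + e ^+ 2 * T.
  rewrite /P /Q /T -sumrB !mulr_sumr -sumrB -big_split /=.
  by apply: eq_bigr => i _; ring.
rewrite leNgt; apply/negP => QP.
have d0 : 0 < P - Q by rewrite subr_gt0.
have dT : 0 < P - Q + T by rewrite ltr_pwDl.
(* The squared norm is P - 2 e (P - Q) + e^2 T; at this e it is below P. *)
have := minp ((P - Q) / (P - Q + T)); rewrite expand.
have -> : 0 <= (P - Q) / (P - Q + T) <= 1.
  by rewrite divr_ge0 ?(ltW d0) ?(ltW dT) //= ler_pdivrMr // mul1r lerDl.
move=> /(_ isT); set e := _ / _ => le_e.
have e0 : 0 < e by rewrite divr_gt0.
have eT : e * (P - Q + T) = P - Q by rewrite /e divfK // gt_eqF.
have : e * (2 * (P - Q) - e * T) <= 0 by lra.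
rewrite pmulr_rle0 // => le0.
have : 0 < e * (P - Q) by rewrite mulr_gt0.
lra.
Qed.

(** Gordan's alternative for the joint range of quadratic forms on the sphere.
    Let p be the point of least norm in the hull.  If p is not 0, then
    <p, f(x)> >= |p|^2 at every unit x, since the segment from p to f(x) stays
    in the hull.  To keep the number of vectors in the family fixed along this
    segment, one of them is first made zero, and x takes its place. *)
Lemma qforms_gordan (I : finType) N (M : I -> 'M[R]_N) :
  (0 < N)%N ->
  (exists m (w : 'I_m -> 'rV[R]_N), \sum_j qform 1%:M (w j) = 1 /\
     forall i, \sum_j qform (M i) (w j) = 0)
  \/ (exists (c : I -> R) (mu : R), 0 < mu /\
        forall x, qform 1%:M x = 1 -> mu <= \sum_i c i * qform (M i) x).
Proof.
move=> N0; pose m := #|I|.+2.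
have [w w1 minw] := @qform_family_minimizer I N m M N0 isT.
(* With the squared norm as one more form, the reduction preserves it too. *)
pose M' (o : option I) := if o is Some i then M i else 1%:M.
have [w' [[j0 w'j0] eqw']] := @qform_family_zero_row _ N m M' w
  (eq_leq (congr1 S (card_option _))).
pose p i := \sum_j qform (M i) (w j).
have [p0|p0] := eqVneq (\sum_i p i ^+ 2) 0.
  left; exists m, w; split=> // i; apply/eqP; rewrite -sqrf_eq0; apply/eqP.
  by move: i (isT : true); apply/psumr_eq0P => // i _; exact: sqr_ge0.
right; exists p, (\sum_i p i ^+ 2); split.
  by rewrite lt_def p0 sumr_ge0 // => i _; exact: sqr_ge0.
move=> x x1; apply: sum_sqr_segment_min => e /andP[e0 e1].
pose u j := if j == j0 then Num.sqrt e *: x else Num.sqrt (1 - e) *: w' j.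
have sum_u o : \sum_j qform (M' o) (u j) =
    (1 - e) * (\sum_j qform (M' o) (w j)) + e * qform (M' o) x.
  rewrite -eqw' [in RHS](bigD1 j0) //= w'j0 qform0 add0r.
  rewrite (bigD1 j0) //= {1}/u eqxx qformZ sqr_sqrtr // addrC mulr_sumr.
  congr (_ + _); apply: eq_bigr => j /negPf jj0.
  by rewrite /u jj0 qformZ sqr_sqrtr // subr_ge0.
have u1 : \sum_j qform 1%:M (u j) = 1.
  by rewrite (sum_u None) /= w1 x1; ring.
apply: le_trans (minw u u1) _; rewrite le_eqVlt; apply/orP; left; apply/eqP.
by apply: eq_bigr => i _; rewrite (sum_u (Some i)).
Qed.

End QuadraticForms.

(** * The ground field and the real inner product *)

Section Scalars.
Variables (R : realType) (b : ground).
Local Notation F := (scalars R b).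
Local Notation conj := (@sconj R b).
Local Notation re := (@sre R b).
Local Notation real := (@of_real R b).

Lemma sconj_zmod : zmod_morphism conj.
Proof. by case: b => x y //=; rewrite rmorphB. Qed.
Lemma sconj_monoid : monoid_morphism conj.
Proof.
case: b; split=> [|x y] //=; first exact: (rmorph1 (@conjc R)).
exact: (rmorphM (@conjc R)).
Qed.
HB.instance Definition _ := GRing.isZmodMorphism.Build F F conj sconj_zmod.
HB.instance Definition _ := GRing.isMonoidMorphism.Build F F conj sconj_monoid.

Lemma of_real_zmod : zmod_morphism real.
Proof. by case: b => x y //=; rewrite rmorphB. Qed.
Lemma of_real_monoid : monoid_morphism real.
Proof. by case: b; split=> [|x y] /=; rewrite ?rmorph1 ?rmorphM. Qed.
HB.instance Definition _ := GRing.isZmodMorphism.Build R F real of_real_zmod.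
HB.instance Definition _ :=
  GRing.isMonoidMorphism.Build R F real of_real_monoid.

Lemma sre_zmod : zmod_morphism re.
Proof. by case: b => //= -[x1 x2] [y1 y2]. Qed.
HB.instance Definition _ := GRing.isZmodMorphism.Build F R re sre_zmod.

Lemma sconjK : involutive conj.
Proof. by case: b => //= x; exact: conjcK. Qed.
Lemma sconj_of_real a : conj (real a) = real a.
Proof. by case: b => //=; exact: conjc_real. Qed.
Lemma sre_conj z : re (conj z) = re z.
Proof. by case: b z => //= -[]. Qed.
Lemma sre_realM a z : re (real a * z) = a * re z.
Proof. by case: b z => //= -[x y] /=; rewrite mul0r subr0. Qed.
Lemma sre_conjM_ge0 z : 0 <= re (conj z * z).
Proof.
case: b z => //= [z|[x y] /=]; first by rewrite -expr2 sqr_ge0.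
by rewrite mulNr opprK addr_ge0 // -expr2 sqr_ge0.
Qed.
Lemma sre_conjM_eq0 z : re (conj z * z) = 0 -> z = 0.
Proof.
case: b z => [z|[x y]] /=; first by move/eqP; rewrite mulf_eq0 orbb => /eqP.
rewrite mulNr opprK => /eqP; rewrite paddr_eq0 -?expr2 ?sqr_ge0 //.
by rewrite !sqrf_eq0 => /andP[/eqP-> /eqP->].
Qed.

(** The imaginary unit, if any; [0] over the reals makes the forms that it
    multiplies vanish, so that both ground fields can be treated alike. *)
Definition siota : F :=
  match b return scalars R b with Reals => 0 | Complexes => 'i%C end.

Lemma scalar_eq0 z : re z = 0 -> re (siota * z) = 0 -> z = 0.
Proof.
rewrite /siota; case: b z => //= -[x y] /= -> .
by rewrite mul0r mul1r sub0r => /eqP; rewrite oppr_eq0 => /eqP ->.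
Qed.

Section Adjoint.
Variables m n p : nat.

Lemma adjmxK : cancel (@adjmx R b m n) (@adjmx R b n m).
Proof.
by move=> A; apply/matrixP => i j; rewrite !mxE sconjK.
Qed.

Lemma adjmxM (A : 'M[F]_(m, n)) (B : 'M[F]_(n, p)) :
  adjmx (A *m B) = adjmx B *m adjmx A.
Proof. by rewrite /adjmx map_mxM trmx_mul. Qed.

Lemma adjmxZ a (A : 'M[F]_(m, n)) : adjmx (a *: A) = conj a *: adjmx A.
Proof. by rewrite /adjmx map_mxZ linearZ. Qed.
End Adjoint.

(** The real inner product underlying the Hermitian one: its values are in [R]
    for both ground fields. *)
Definition rip n (u v : 'cV[F]_n) : R := re ((adjmx u *m v) 0 0).

Section RealInnerProduct.
Variable n : nat.
Implicit Types (u v w : 'cV[F]_n) (A : 'M[F]_n).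

Lemma ripC u v : rip u v = rip v u.
Proof.
rewrite /rip -sre_conj; congr (re _).
transitivity (adjmx (adjmx u *m v) 0 0).
  by rewrite /adjmx [RHS]mxE [RHS]mxE.
by rewrite adjmxM adjmxK.
Qed.

Lemma ripDr u v w : rip u (v + w) = rip u v + rip u w.
Proof. by rewrite /rip mulmxDr mxE raddfD. Qed.
Lemma ripDl u v w : rip (v + w) u = rip v u + rip w u.
Proof. by rewrite ripC ripDr !(ripC u). Qed.
Lemma ripBr u v w : rip u (v - w) = rip u v - rip u w.
Proof. by rewrite /rip mulmxBr !mxE raddfB. Qed.
Lemma ripBl u v w : rip (v - w) u = rip v u - rip w u.
Proof. by rewrite ripC ripBr !(ripC u). Qed.
Lemma ripZr u a v : rip u (real a *: v) = a * rip u v.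
Proof. by rewrite /rip -scalemxAr mxE sre_realM. Qed.
Lemma ripZl u a v : rip (real a *: v) u = a * rip v u.
Proof. by rewrite ripC ripZr ripC. Qed.
Lemma rip0r u : rip u 0 = 0.
Proof. by rewrite /rip mulmx0 mxE raddf0. Qed.
Lemma rip0l u : rip 0 u = 0.
Proof. by rewrite ripC rip0r. Qed.
Lemma rip_sumr u (J : Type) (r : seq J) (P : pred J) (f : J -> 'cV[F]_n) :
  rip u (\sum_(j <- r | P j) f j) = \sum_(j <- r | P j) rip u (f j).
Proof. by apply: (big_morph (rip u)); [exact: ripDr|exact: rip0r]. Qed.
Lemma rip_suml u (J : Type) (r : seq J) (P : pred J) (f : J -> 'cV[F]_n) :
  rip (\sum_(j <- r | P j) f j) u = \sum_(j <- r | P j) rip (f j) u.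
Proof. by rewrite ripC rip_sumr; apply: eq_bigr => j _; exact: ripC. Qed.

Lemma ripE u : rip u u = \sum_i re (conj (u i 0) * u i 0).
Proof.
by rewrite /rip mxE raddf_sum; apply: eq_bigr => i _; rewrite !mxE.
Qed.
Lemma rip_ge0 u : 0 <= rip u u.
Proof. by rewrite ripE sumr_ge0 // => i _; exact: sre_conjM_ge0. Qed.
Lemma rip_eq0 u : rip u u = 0 -> u = 0.
Proof.
rewrite ripE => u0; apply/matrixP => i j; rewrite (ord1 j) mxE.
apply: sre_conjM_eq0; move: i (isT : true); apply/psumr_eq0P => // i _.
exact: sre_conjM_ge0.
Qed.

Lemma rip_adjl A u v : rip (A *m u) v = rip u (adjmx A *m v).
Proof. by rewrite /rip adjmxM -!mulmxA. Qed.
Lemma rip_mul A B u : rip (A *m u) (B *m u) = rip u (adjmx A *m B *m u).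
Proof. by rewrite rip_adjl mulmxA. Qed.

Lemma norm2_eq1 u : (norm2 u = 1) <-> (rip u u = 1).
Proof.
rewrite /norm2 -/(rip u u); split=> [h|->]; last exact: sqrtr1.
by rewrite -(sqr_sqrtr (rip_ge0 u)) h expr1n.
Qed.

(** Over the complex numbers the basis consists of the standard basis vectors
    and their multiples by the imaginary unit. *)
Lemma real_orthonormal_basis : exists N (e : 'I_N -> 'cV[F]_n),
  (forall i j, rip (e i) (e j) = (i == j)%:R) /\
  forall v, v = \sum_i real (rip (e i) v) *: e i.
Proof.
rewrite /rip; case: b => /=.
  exists n, (fun i => delta_mx i 0); split=> [i j|v].
    rewrite mxE (bigD1 i) //= big1 => [|k /negPf ki].
      by rewrite !mxE !eqxx mul1r andbT addr0.
    by rewrite !mxE ki mul0r.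
  rewrite [LHS]matrix_sum_delta; apply: eq_bigr => i _.
  rewrite big_ord1; congr (_ *: _); rewrite mxE (bigD1 i) //= big1.
    by rewrite !mxE !eqxx mul1r addr0.
  by move=> k /negPf ki; rewrite !mxE ki mul0r.
pose e (i : 'I_(n + n)) : 'cV[R[i]]_n := match split i with
  | inl j => delta_mx j 0 | inr j => 'i%C *: delta_mx j 0 end.
have el j (v : 'cV[R[i]]_n) :
    (@adjmx R Complexes _ _ (e (lshift n j)) *m v) 0 0 = v j 0.
  rewrite /e (unsplitK (inl _)) mxE (bigD1 j) //= big1 => [|k /negPf kj].
    by rewrite !mxE !eqxx rmorph1 mul1r addr0.
  by rewrite !mxE kj rmorph0 mul0r.
have er j (v : 'cV[R[i]]_n) :
    (@adjmx R Complexes _ _ (e (rshift n j)) *m v) 0 0 = - 'i%C * v j 0.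
  rewrite /e (unsplitK (inr _)) mxE (bigD1 j) //= big1 => [|k /negPf kj].
    rewrite !mxE !eqxx mulr1 addr0; congr (_ * _).
    by apply/eqP; rewrite eq_complex /= oppr0 !eqxx.
  by rewrite !mxE kj mulr0 rmorph0 mul0r.
exists (n + n)%N, e; split=> [i j|v].
  rewrite -(splitK i) -(splitK j).
  case: (split i) => i'; case: (split j) => j' /=; rewrite ?el ?er /e
    ?(unsplitK (inl _)) ?(unsplitK (inr _)) !mxE ?eqxx ?andbT
    ?eq_lshift ?eq_rshift ?eq_lrshift ?eq_rlshift.
  - by case: (_ == _).
  - by case: (_ == _); rewrite ?mulr1 ?mulr0.
  - by case: (_ == _); rewrite ?mulr1 ?mulr0 //= oppr0.
  - by case: (_ == _); rewrite ?mulr1 ?mulr0 //= ?mulr0 ?oppr0 //=; ring.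
rewrite big_split_ord /= -big_split /=; apply/matrixP => i j; rewrite (ord1 j).
rewrite summxE (bigD1 i) //= big1 => [|k /negPf ki].
  rewrite el er /e (unsplitK (inl _)) (unsplitK (inr _)) !mxE !eqxx addr0.
  apply/eqP; case: (v i 0) => x y; rewrite eq_complex /=.
  by apply/andP; split; apply/eqP; ring.
rewrite el er /e (unsplitK (inl _)) (unsplitK (inr _)) !mxE eq_sym ki /=.
by rewrite !mulr0 addr0.
Qed.

End RealInnerProduct.
End Scalars.

(** * Quadratic forms on vectors over the ground field *)

Section FormsOverGround.
Variables (R : realType) (b : ground) (n : nat).
Local Notation F := (scalars R b).
Local Notation real := (@of_real R b).

(** In real orthonormal coordinates every v |-> Re (v^H A v) is a real quadratic
    form, and the square norm is the standard one. *)
Lemma rip_realification : exists N (vec : 'rV[R]_N -> 'cV[F]_n)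
    (form : 'M[F]_n -> 'M[R]_N),
  [/\ forall A x, rip (vec x) (A *m vec x) = qform (form A) x,
      forall x, rip (vec x) (vec x) = qform 1%:M x
    & forall v, exists x, vec x = v].
Proof.
have [N [e [orth span]]] := real_orthonormal_basis R b n.
pose vec (x : 'rV[R]_N) := \sum_i real (x 0 i) *: e i.
pose form A := \matrix_(i, j) rip (e i) (A *m e j).
have formE A x : rip (vec x) (A *m vec x) = qform (form A) x.
  rewrite qformE /vec mulmx_sumr rip_sumr; apply: eq_bigr => k _.
  rewrite -scalemxAr ripZr rip_suml mulrC; congr (_ * _).
  by apply: eq_bigr => l _; rewrite ripZl mxE.
exists N, vec, form; split=> // [x|v].
  rewrite -{2}(mul1mx (vec x)) formE; congr (qform _ x).
  by apply/matrixP => i j; rewrite !mxE mul1mx orth.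
exists (\row_i rip (e i) v); rewrite [RHS]span.
by apply: eq_bigr => i _; rewrite mxE.
Qed.

Lemma rip_forms_gordan (I : finType) (A : I -> 'M[F]_n) :
  (0 < n)%N ->
  (exists m (w : 'I_m -> 'cV[F]_n), \sum_j rip (w j) (w j) = 1 /\
     forall i, \sum_j rip (w j) (A i *m w j) = 0)
  \/ (exists (c : I -> R) (mu : R), 0 < mu /\
        forall v, rip v v = 1 -> mu <= \sum_i c i * rip v (A i *m v)).
Proof.
move=> n0; have [N [vec [form [formE normE onto]]]] := rip_realification.
have N0 : (0 < N)%N.
  case: N vec form formE normE onto => // vec form _ _ onto.
  have [x xE] := onto (const_mx 1); have [y yE] := onto 0.
  move: xE; rewrite (thinmx0 x) -(thinmx0 y) yE.
  by move/matrixP/(_ (Ordinal n0) 0)/eqP; rewrite !mxE eq_sym oner_eq0.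
have [[m [w [w1 w0]]]|[c [mu [mu0 cmu]]]] := qforms_gordan (form \o A) N0.
  left; exists m, (vec \o w); split=> [|i].
    by rewrite -w1; apply: eq_bigr => j _; rewrite normE.
  by rewrite -[RHS](w0 i); apply: eq_bigr => j _; rewrite formE.
right; exists c, mu; split=> // v; have [x <-] := onto v.
rewrite normE => /cmu /le_trans; apply; rewrite le_eqVlt; apply/orP; left.
by apply/eqP; apply: eq_bigr => i _; rewrite formE.
Qed.

Lemma rip_form_bounded (A : 'M[F]_n) :
  exists2 C, 0 <= C & forall v, rip v (A *m v) <= C * rip v v.
Proof.
have [N [vec [form [formE normE onto]]]] := rip_realification.
exists (\sum_k \sum_l `|form A l k|).
  by apply: sumr_ge0 => k _; apply: sumr_ge0.
by move=> v; have [x <-] := onto v; rewrite formE normE; exact: qform_le.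
Qed.

Lemma unit_vector v : v != 0 :> 'cV[F]_n ->
  rip (real (norm2 v)^-1 *: v) (real (norm2 v)^-1 *: v) = 1.
Proof.
move=> v0; rewrite ripZl ripZr mulrA -expr2 exprVn sqr_sqrtr ?rip_ge0 //.
by rewrite mulVf //; apply: contra_neq v0; exact: rip_eq0.
Qed.

Lemma exists_unit_vector : (0 < n)%N -> exists v : 'cV[F]_n, rip v v = 1.
Proof.
move=> n0; eexists; apply: (@unit_vector (const_mx 1)).
by apply/eqP => /matrixP/(_ (Ordinal n0) 0)/eqP; rewrite !mxE oner_eq0.
Qed.

End FormsOverGround.

(** * The spectral norm and its maximal right singular space *)

Section SpectralNorm.
Variables (R : realType) (b : ground) (n : nat).
Hypothesis n_gt0 : (0 < n)%N.
Local Notation F := (scalars R b).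
Local Notation real := (@of_real R b).
Implicit Types (A : 'M[F]_n) (u v : 'cV[F]_n).

Lemma sqr_norm2 (v : 'cV[F]_n) : norm2 v ^+ 2 = rip v v.
Proof. by rewrite sqr_sqrtr // rip_ge0. Qed.

Lemma spectral_set_nonempty A :
  [set norm2 (A *m v) | v in [set v : 'cV[F]_n | norm2 v = 1]] !=set0.
Proof.
have [v v1] := exists_unit_vector R b n_gt0.
by exists (norm2 (A *m v)), v => //; apply/norm2_eq1.
Qed.

Lemma norm2_le_spectral_norm A v :
  norm2 v = 1 -> norm2 (A *m v) <= spectral_norm A.
Proof.
move=> v1; apply: ub_le_sup; last by exists v.
have [C C0 leC] := rip_form_bounded (adjmx A *m A).
exists (Num.sqrt C) => _ [u /norm2_eq1 u1 <-].
rewrite ler_wsqrtr // -/(rip _ _) rip_mul; have := leC u.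
by rewrite u1 mulr1.
Qed.

Lemma spectral_norm_ge0 A : 0 <= spectral_norm A.
Proof.
have [v /norm2_eq1 v1] := exists_unit_vector R b n_gt0.
exact: le_trans (sqrtr_ge0 _) (norm2_le_spectral_norm A v1).
Qed.

Lemma rip_mul_le A v : rip (A *m v) (A *m v) <= spectral_norm A ^+ 2 * rip v v.
Proof.
have [->|v0] := eqVneq v 0; first by rewrite mulmx0 !rip0l mulr0.
have [c [u [u1 ->]]] : exists c u, rip u u = 1 /\ v = real c *: u.
  exists (norm2 v), (real (norm2 v)^-1 *: v); split; first exact: unit_vector.
  rewrite scalerA -rmorphM divff ?rmorph1 ?scale1r //.
  by apply: contra_neq v0 => vz; apply: rip_eq0; rewrite -sqr_norm2 vz expr0n.
have /norm2_eq1/(norm2_le_spectral_norm A) := u1.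
rewrite -ler_sqr ?nnegrE ?sqrtr_ge0 ?spectral_norm_ge0 // sqr_norm2 => leu.
rewrite -scalemxAr !(ripZl, ripZr) u1 mulr1 mulrA.
rewrite [leRHS](_ : _ = c * c * spectral_norm A ^+ 2); last by ring.
by rewrite ler_wpM2l // -expr2 sqr_ge0.
Qed.

Lemma sqr_spectral_norm_le A C :
  (forall v, rip v v = 1 -> rip (A *m v) (A *m v) <= C) ->
  spectral_norm A ^+ 2 <= C.
Proof.
move=> leC; have [v v1] := exists_unit_vector R b n_gt0.
have C0 : 0 <= C by exact: le_trans (rip_ge0 _) (leC v v1).
rewrite -(sqr_sqrtr C0) ler_sqr ?nnegrE ?sqrtr_ge0 ?spectral_norm_ge0 //.
apply: ge_sup (spectral_set_nonempty A) _ => _ [u /norm2_eq1 u1 <-].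
by rewrite ler_wsqrtr //; exact: leC.
Qed.

Lemma spectral_norm_eq0 A : spectral_norm A = 0 -> A = 0.
Proof.
move=> A0; apply/matrixP => i j; rewrite mxE.
have Aj : A *m delta_mx j 0 = 0 :> 'cV[F]_n.
  apply: rip_eq0; apply/eqP; rewrite eq_le rip_ge0 andbT.
  by apply: le_trans (rip_mul_le _ _) _; rewrite A0 expr0n mul0r.
by move/matrixP/(_ i 0): Aj; rewrite -colE !mxE.
Qed.

(** Nonnegative by the definition of the norm; it measures how far v is from
    being a maximal right singular vector. *)
Definition norm_defect A v :=
  spectral_norm A ^+ 2 * rip v v - rip (A *m v) (A *m v).

Lemma norm_defect_ge0 A v : 0 <= norm_defect A v.
Proof. by rewrite subr_ge0 rip_mul_le. Qed.

Lemma norm_defectE A v :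
  norm_defect A v =
  rip v (((real (spectral_norm A ^+ 2))%:M - adjmx A *m A) *m v).
Proof.
by rewrite /norm_defect mulmxBl mul_scalar_mx ripBr ripZr -rip_mul.
Qed.

(** A zero of a nonnegative quadratic form is a critical point.  Here z is half
    the gradient at v; if it were not zero, moving from v against z would make
    the defect negative. *)
Lemma norm_defect_eq0 A v : norm_defect A v = 0 ->
  adjmx A *m (A *m v) = real (spectral_norm A ^+ 2) *: v.
Proof.
move=> v0; set s2 := spectral_norm A ^+ 2.
have [z zE] : exists z, z = real s2 *: v - adjmx A *m (A *m v) by eexists.
suff : z = 0 by rewrite zE => /eqP; rewrite subr_eq0 => /eqP.
have zv : s2 * rip v z - rip (A *m v) (A *m z) = rip z z.
  rewrite {4}zE ripBr ripZr -(rip_adjl A z).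
  by rewrite (ripC z v) (ripC (A *m z)).
apply: rip_eq0; apply/eqP; rewrite eq_le rip_ge0 andbT leNgt; apply/negP => z0.
have kz0 := norm_defect_ge0 A z; have k1 : 0 < norm_defect A z + 1 by lra.
pose t := - (rip z z / (norm_defect A z + 1)).
have := norm_defect_ge0 A (v + real t *: z).
have -> : norm_defect A (v + real t *: z) =
    2 * t * rip z z + t ^+ 2 * norm_defect A z.
  rewrite -zv -[RHS]add0r -v0 /norm_defect -/s2 mulmxDr -scalemxAr.
  rewrite !(ripDl, ripDr, ripZl, ripZr) (ripC z v) (ripC (A *m z) (A *m v)).
  ring.
have tE : t * (norm_defect A z + 1) = - rip z z.
  by rewrite mulNr divfK // gt_eqF.
have t0 : t < 0 by rewrite oppr_lt0 divr_gt0.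
have : t * (2 * rip z z + t * norm_defect A z) < 0.
  by rewrite nmulr_rlt0 //; lra.
lra.
Qed.

(** With s = ||A||, the equation A^H A v = s^2 v is linear in v, so it passes
    from the singular vectors to their span. *)
Lemma max_right_singular_space_norm_defect A v :
  max_right_singular_space A v -> norm_defect A v = 0.
Proof.
case=> vs [vsS vvs].
have eigen w : w \in vs ->
    adjmx A *m (A *m w) = real (spectral_norm A ^+ 2) *: w.
  move=> /vsS[_ [u [_ -> Au]]]; rewrite -scalemxAr Au scalerA -rmorphM.
  by rewrite expr2.
have eigen_v : adjmx A *m (A *m v) = real (spectral_norm A ^+ 2) *: v.
  rewrite (coord_span (X := in_tuple vs) vvs) scaler_sumr !mulmx_sumr.
  apply: eq_bigr => i _; rewrite -!scalemxAr eigen ?mem_nth //.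
  by rewrite !scalerA mulrC.
by rewrite /norm_defect rip_adjl eigen_v ripZr subrr.
Qed.

(** Such a v is itself a right singular vector: its left partner is A v divided
    by the norm of A. *)
Lemma norm_defect_max_right_singular_space A v : 0 < spectral_norm A ->
  norm2 v = 1 -> norm_defect A v = 0 -> max_right_singular_space A v.
Proof.
move=> s0 v1 v0; have eigen := norm_defect_eq0 v0.
have rs0 : real (spectral_norm A) != 0 by rewrite fmorph_eq0 gt_eqF.
exists [:: v]; split; last by rewrite memv_span ?mem_head.
move=> w; rewrite inE => /eqP ->; split=> //.
exists (real (spectral_norm A)^-1 *: (A *m v)); split.
- apply/norm2_eq1; move: v0; rewrite ripZl ripZr mulrA /norm_defect.
  move/norm2_eq1: v1 => ->; rewrite mulr1 => /eqP; rewrite subr_eq0 => /eqP <-.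
  by rewrite -expr2 exprVn mulVf // sqrf_eq0 gt_eqF.
- by rewrite scalerA -rmorphM divff ?rmorph1 ?scale1r // gt_eqF.
- rewrite -scalemxAr eigen scalerA -rmorphM; congr (real _ *: _).
  by rewrite expr2 mulKf // gt_eqF.
Qed.

End SpectralNorm.

(** * Best approximation in the spectral norm *)

Section Optimality.
Variables (R : realType) (b : ground) (n : nat).
Hypothesis n_gt0 : (0 < n)%N.
Local Notation F := (scalars R b).
Local Notation re := (@sre R b).
Local Notation real := (@of_real R b).
Local Notation iota := (@siota R b).

Lemma rip_mulZ (v : 'cV[F]_n) a (A : 'M[F]_n) :
  rip v ((a *: A) *m v) = re (a * (adjmx v *m A *m v) 0 0).
Proof. by rewrite /rip -scalemxAl -scalemxAr mxE mulmxA. Qed.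

(** Put s = ||D||.  For a unit vector v one has
    |(D - e W) v|^2 = s^2 - defect(v) - 2 e Re <D v, W v> + e^2 |W v|^2.
    The hypothesis bounds the last three terms by
    - (1 - 2 e |lam|) defect(v) - 2 e mu + e^2 B, where B bounds |W v|^2, and
    this is at most - e mu as soon as 2 e |lam| <= 1 and e B <= mu. *)
Lemma spectral_norm_decrease (D W : 'M[F]_n) (lam mu : R) :
  0 < mu -> 0 < spectral_norm D ->
  (forall v, rip v v = 1 ->
    mu <= rip (D *m v) (W *m v) + lam * norm_defect D v) ->
  exists e, spectral_norm (D - real e *: W) < spectral_norm D.
Proof.
move=> mu0 s0 sep.
have [B B0 leB] := rip_form_bounded (adjmx W *m W).
(* The step mu / q satisfies both requirements; the 1 makes q positive. *)
pose q := 2 * `|lam| * mu + B + 1.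
have q0 : 0 < q by rewrite ltr_wpDl // addr_ge0 // !mulr_ge0 // ltW.
pose e := mu / q; have e0 : 0 < e by rewrite divr_gt0.
have eq_mu : e * q = mu by rewrite divfK // gt_eqF.
clearbody e.
have e_lam : 2 * e * `|lam| <= 1.
  rewrite -(ler_pM2r mu0) mul1r -{2}eq_mu /q.
  have : 0 <= e * B by rewrite mulr_ge0 // ltW.
  by lra.
have eB : e * B <= mu.
  rewrite -eq_mu /q.
  have : 0 <= e * (2 * `|lam| * mu) by rewrite !mulr_ge0 // ltW.
  by lra.
exists e; rewrite -ltr_sqr ?nnegrE ?spectral_norm_ge0 //.
apply: le_lt_trans (_ : spectral_norm D ^+ 2 - e * mu < _); last first.
  by rewrite ltrBlDr ltrDl mulr_gt0.
apply: sqr_spectral_norm_le => // v v1.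
have := sep v v1; have := norm_defect_ge0 n_gt0 D v; have := leB v.
rewrite -rip_mul v1 mulr1 mulmxBl -scalemxAl.
rewrite !(ripBl, ripBr, ripZl, ripZr) (ripC (W *m v) (D *m v)).
rewrite /norm_defect v1 mulr1.
set s2 := spectral_norm D ^+ 2; set dd := rip (D *m v) (D *m v).
set dw := rip (D *m v) (W *m v); set ww := rip (W *m v) (W *m v).
move=> wwB h0 le_mu.
have h1 : lam * (s2 - dd) <= `|lam| * (s2 - dd).
  by rewrite ler_wpM2r // ler_norm.
have h2 : 2 * e * (mu - dw - `|lam| * (s2 - dd)) <= 0.
  by rewrite pmulr_rle0 ?mulr_gt0 //; lra.
have h3 : 0 <= (1 - 2 * e * `|lam|) * (s2 - dd) by rewrite mulr_ge0 // subr_ge0.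
have h4 : e * (e * ww) <= e * mu.
  rewrite ler_pM2l //; apply: le_trans eB; rewrite ler_pM2l //.
by lra.
Qed.

(** The weights are the squared norms and the points come from the normalized
    vectors; a zero vector has weight 0, and any point of the field serves. *)
Lemma convex_hull_restricted_field0 k (A : 'I_k -> 'M[F]_n)
    (S : set 'cV[F]_n) m (w : 'I_m -> 'cV[F]_n) :
  \sum_j rip (w j) (w j) = 1 ->
  (forall i, \sum_j (adjmx (w j) *m A i *m w j) 0 0 = 0) ->
  (forall j, w j != 0 -> S (real (norm2 (w j))^-1 *: w j)) ->
  convex_hull (restricted_field A S) 0.
Proof.
move=> w1 w0 wS.
have [j0 wj0] : exists j0, w j0 != 0.
  apply/existsP; apply: contraT; rewrite negb_exists => /forallP wz.
  move: w1; rewrite big1 => [/eqP|j _]; first by rewrite eq_sym oner_eq0.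
  by have := wz j; rewrite negbK => /eqP ->; rewrite rip0l.
pose u j := real (norm2 (w j))^-1 *: w j.
pose v j := if w j == 0 then u j0 else u j.
exists m, (fun j => rip (w j) (w j)),
  (fun j => \col_i (adjmx (v j) *m A i *m v j) 0 0).
split=> // [j|j|]; first exact: rip_ge0.
  exists (v j) => //; rewrite /v; case: eqVneq => [_|wj].
    by split; [exact: wS | apply/norm2_eq1/unit_vector].
  by split; [exact: wS | apply/norm2_eq1/unit_vector].
apply/matrixP => i l; rewrite (ord1 l) mxE summxE -[LHS](w0 i).
apply: eq_bigr => j _; rewrite [RHS]mxE [X in _ = _ * X]mxE /v.
case: eqVneq => [->|wj].
  by rewrite rip0l rmorph0 mul0r mulmx0 mxE.
rewrite /u adjmxZ sconj_of_real -!(scalemxAl, scalemxAr).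
rewrite [X in _ = _ * X]mxE [X in _ = _ * (_ * X)]mxE.
rewrite !mulrA -!rmorphM -sqr_norm2 -mulrA -expr2 -exprMn mulfV ?expr1n.
  by rewrite rmorph1 mul1r.
by apply: contra_neq wj => wz; apply: rip_eq0; rewrite -sqr_norm2 wz expr0n.
Qed.

(** The functional given by the alternative has real coefficients c on the real
    and on the imaginary parts; recombined into scalars, they are the
    coefficients of the direction W in which the norm decreases. *)
Lemma hull_of_best_approximation k (X : k.-tuple 'M[F]_n) (D : 'M[F]_n) :
  D != 0 ->
  (forall W, W \in <<X>>%VS -> spectral_norm D <= spectral_norm (D - W)) ->
  convex_hull (restricted_field (fun i => adjmx D *m tnth X i)
    (max_right_singular_space D)) (0 : 'cV[F]_k).
Proof.
move=> D0 minD.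
have s0 : 0 < spectral_norm D.
  rewrite lt_def spectral_norm_ge0 // andbT.
  by apply: contra_neq D0; exact: spectral_norm_eq0.
pose A (o : ('I_k + 'I_k) + unit) := match o with
  | inl (inl i) => 1 *: (adjmx D *m tnth X i)
  | inl (inr i) => iota *: (adjmx D *m tnth X i)
  | inr _ => (real (spectral_norm D ^+ 2))%:M - adjmx D *m D end.
have [[m [w [w1 w0]]]|[c [mu [mu0 sep]]]] := rip_forms_gordan A n_gt0.
  apply: (convex_hull_restricted_field0 w1) => [i|j wj].
    apply: scalar_eq0; rewrite ?mulr_sumr raddf_sum /=.
      rewrite -[RHS](w0 (inl (inl i))); apply: eq_bigr => j _.
      by rewrite rip_mulZ mul1r.
    rewrite -[RHS](w0 (inl (inr i))); apply: eq_bigr => j _.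
    by rewrite rip_mulZ.
  apply: norm_defect_max_right_singular_space => //.
    exact/norm2_eq1/unit_vector.
  (* The terms are nonnegative and sum to 0. *)
  have gw : norm_defect D (w j) = 0.
    move: j {wj} (isT : true); apply/psumr_eq0P => [j _|].
      exact: norm_defect_ge0.
    rewrite -[RHS](w0 (inr tt)); apply: eq_bigr => j _; exact: norm_defectE.
  by rewrite norm_defectE -scalemxAr ripZl ripZr -norm_defectE gw !mulr0.
pose W := \sum_i (real (c (inl (inl i))) + real (c (inl (inr i))) * iota)
  *: tnth X i.
have WX : W \in <<X>>%VS.
  by apply: memv_suml => i _; rewrite memvZ // memv_span // mem_tnth.
have [v v1|e] := @spectral_norm_decrease D W (c (inr tt)) mu mu0 s0.
  apply: le_trans (sep v v1) _; rewrite !big_sumType /=.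
  rewrite [X in _ + X](big_pred1 tt); last by case.
  rewrite -norm_defectE.
  rewrite lerD2r le_eqVlt; apply/orP; left; apply/eqP.
  rewrite -big_split rip_adjl /W mulmx_suml mulmx_sumr rip_sumr /=.
  apply: eq_bigr => i _; rewrite scalerDl mulmxDl mulmxDr ripDr.
  by rewrite -!scalemxAl -!scalemxAr -scalerA !ripZr scale1r mulmxA.
by rewrite ltNge minD // memvZ.
Qed.

(** Duality: t and the v_j give a lower bound for ||D - W|| that is independent
    of W because the terms linear in W average to 0. *)
Lemma best_approximation_of_hull k (X : k.-tuple 'M[F]_n) (D : 'M[F]_n) :
  convex_hull (restricted_field (fun i => adjmx D *m tnth X i)
    (max_right_singular_space D)) (0 : 'cV[F]_k) ->
  forall W, W \in <<X>>%VS -> spectral_norm D <= spectral_norm (D - W).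
Proof.
move=> [m [t [q [t0 t1 qS q0]]]] W WX.
rewrite -ler_sqr ?nnegrE ?spectral_norm_ge0 //.
have point j : spectral_norm D ^+ 2 - 2 * re (\sum_i coord X i W * q j i 0)
    <= spectral_norm (D - W) ^+ 2.
  have [v [/max_right_singular_space_norm_defect vS /norm2_eq1 v1] <-] := qS j.
  have -> : \sum_i coord X i W * (\col_i0 (adjmx v *m (adjmx D *m tnth X i0)
      *m v) 0 0) i 0 = (adjmx v *m (adjmx D *m W *m v)) 0 0.
    rewrite {2}(coord_span WX) mulmx_sumr mulmx_suml mulmx_sumr summxE.
    apply: eq_bigr => i _; rewrite [X in _ * X]mxE (tnth_nth 0).
    by rewrite -scalemxAr -scalemxAl -scalemxAr [RHS]mxE !mulmxA.
  rewrite -/(rip v (adjmx D *m W *m v)) -rip_mul.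
  have := rip_mul_le n_gt0 (D - W) v; rewrite v1 mulr1; apply: le_trans.
  move: vS; rewrite /norm_defect v1 !mulr1 mulmxBl !(ripBl, ripBr).
  rewrite (ripC (W *m v) (D *m v)).
  have := rip_ge0 (W *m v); lra.
have sum0 : \sum_j t j * re (\sum_i coord X i W * q j i 0) = 0.
  transitivity (re (\sum_i coord X i W * (\sum_j real (t j) *: q j) i 0)).
    under eq_bigr do rewrite -sre_realM mulr_sumr.
    rewrite -raddf_sum exchange_big /=; congr (re _); apply: eq_bigr => i _.
    by rewrite summxE mulr_sumr; apply: eq_bigr => j _; rewrite mxE mulrCA.
  by rewrite -q0 big1 ?raddf0 // => i _; rewrite mxE mulr0.
have : \sum_j t j * (spectral_norm D ^+ 2
      - 2 * re (\sum_i coord X i W * q j i 0))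
    <= \sum_j t j * spectral_norm (D - W) ^+ 2.
  by apply: ler_sum => j _; rewrite ler_wpM2l.
rewrite -mulr_suml t1 mul1r; apply: le_trans.
under eq_bigr do rewrite mulrBr (mulrCA _ 2).
by rewrite sumrB -mulr_suml t1 mul1r -mulr_sumr sum0 mulr0 subr0.
Qed.

End Optimality.

Theorem corollary11 (R : realType) (b : ground) (n k : nat)
    (X : k.-tuple 'M[scalars R b]_n) (Y Xs : 'M[scalars R b]_n)
    (k_gt0 : (0 < k)%N)
    (dimX : \dim <<X>>%VS = k)
    (YX : Y \notin <<X>>%VS)
    (XsX : Xs \in <<X>>%VS) :
  (forall Z : 'M[scalars R b]_n, Z \in <<X>>%VS ->
     spectral_norm (Y - Xs) <= spectral_norm (Y - Z))
  <->
  convex_hull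
    (restricted_field (fun i : 'I_k => adjmx (Y - Xs) *m tnth X i)
       (max_right_singular_space (Y - Xs)))
    (0 : 'cV[scalars R b]_k).
Proof.
(* For n = 0 the only matrix is 0, which is in every span. *)
have n_gt0 : (0 < n)%N.
  by case: n X Y Xs YX {dimX XsX} => // X' Y' _; rewrite (flatmx0 Y') mem0v.
have D0 : Y - Xs != 0.
  by apply: contraNneq YX => /eqP; rewrite subr_eq0 => /eqP ->.
split=> [minX|hull Z ZX].
  apply: hull_of_best_approximation => // W WX.
  by rewrite -addrA -opprD; apply: minX; exact: memvD.
rewrite (_ : Y - Z = Y - Xs - (Z - Xs)); last by rewrite opprB addrA subrK.
by apply: (best_approximation_of_hull n_gt0 hull); exact: memvB.
Qed.
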